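(* Let $\mathcal{P}=\langle X\mid R\rangle$ be a monoid presentation with $R$ symmetric. 1. If $\mathcal{P}$ is finitely generated decidable (i.e. $X$ is finite and $R$ is decidable), then the following are equivalent: (i) $\mathcal{P}$ has a solvable Word Problem; (ii) the derivational work function $\Omega:\mathbb{N}^2\to\mathbb{N}$ of $\mathcal{P}$ is computable; (iii) $\Omega$ is bounded above by a computable function $\mathbb{N}^2\to\mathbb{N}$. 2. If $\mathcal{P}$ is finite (i.e. $X$ and $R$ are finite), then the following are equivalent: (i) $\mathcal{P}$ has a solvable Word Problem; (ii) the derivational length function $\mathsf{DL}:\mathbb{N}^2\to\mathbb{N}$ of $\mathcal{P}$ is computable; (iii) $\mathsf{DL}$ is bounded above by a computable function $\mathbb{N}^2\to\mathbb{N}$.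
   Context: $\mathcal{M}(X)$ is the free monoid on $X$, $1$ the empty word, $|w|$ the length of a word $w$. A monoid presentation $\langle X\mid R\rangle$ has $R\subset\mathcal{M}(X)^2$ (the defining relations) and presents $\mathcal{M}(X)/\langle R\rangle$, where $\langle R\rangle$ is the congruence generated by $R$; elements of $\langle R\rangle$ are called relations. $R$ is symmetric if $(u,v)\in R$ implies $(v,u)\in R$. A one step derivation by means of $(a,b)\in R$ is a pair $(xay,xby)$ with $x,y\in\mathcal{M}(X)$; a $k$ steps derivation from $u$ to $v$ is a sequence $(u_0=u,u_1,\dots,u_k=v)$ of words with each $(u_{i-1},u_i)$ a one step derivation ($k=0$ is allowed when $u=v$). Derivational length: for a relation $(u,v)$, $\mathsf{dl}(u,v)$ is the least $k$ such that there is a $k$ steps derivation from $u$ to $v$; $\mathsf{DL}(n_1,n_2)=\max\{\mathsf{dl}(u_1,u_2): (u_1,u_2)\text{ a relation},\ |u_1|\le n_1,\ |u_2|\le n_2\}$. Derivational work: a one step derivation by means of $(a,b)\in R$ has work $|a|+|b|$; the work of a derivation is the sum of the works of its steps; $\mathsf{work}(u_1,u_2)$ for a relation $(u_1,u_2)$ is the minimal work of a derivation from $u_1$ to $u_2$; $\Omega(n_1,n_2)=\max\{\mathsf{work}(u_1,u_2): (u_1,u_2)\text{ a relation},\ |u_1|\le n_1,\ |u_2|\le n_2\}$. $\mathcal{P}$ has a solvable Word Problem if there is an algorithm deciding, for $u,v\in\mathcal{M}(X)$, whether $(u,v)\in\langle R\rangle$. Computable and decidable are meant in the usual sense of recursive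 functions and recursive sets. *)

(* Defs.v *)
From HB Require Import structures.
From mathcomp Require Import all_boot.
From mathcomp Require Import boolp classical_sets cardinality.

Set Implicit Arguments.
Unset Strict Implicit.
Unset Printing Implicit Defensive.

Local Open Scope classical_set_scope.

(** * Recursive functions *)

(* Syntax of the mu-recursive functions; the index is the arity. *)
Inductive recfun : nat -> Type :=
| RZero : recfun 0
| RSucc : recfun 1
| RProj n (i : 'I_n) : recfun n
| RComp m n (f : recfun m) (g : 'I_m -> recfun n) : recfun n
| RPrec n (f : recfun n) (g : recfun n.+2) : recfun n.+1
| RMu n (f : recfun n.+1) : recfun n.

(* [reval c v y]: the partial function denoted by [c] is defined at [v], with
   value [y].  Primitive recursion is on the first argument:
     h(0, v) = f(v)   and   h(k+1, v) = g(k, h(k, v), v);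
   [RMu f] maps [v] to the least [y] with f(y, v) = 0, where f(z, v) has to be
   defined for all z < y. *)
Fixpoint reval n (c : recfun n) : n.-tuple nat -> nat -> Prop :=
  match c in recfun n return n.-tuple nat -> nat -> Prop with
  | RZero => fun _ y => y = 0
  | RSucc => fun v y => y = (thead v).+1
  | RProj _ i => fun v y => y = tnth v i
  | RComp m _ f g => fun v y =>
      exists2 w : m.-tuple nat,
        forall i, reval (g i) v (tnth w i) & reval f w y
  | RPrec n f g => fun v y =>
      let v' : n.-tuple nat := behead_tuple v in
      let fix prec k z :=
        if k is k'.+1 then
          exists2 z', prec k' z' & reval g (cons_tuple k' (cons_tuple z' v')) z
        else reval f v' z in
      prec (thead v) y
  | RMu n f => fun v y =>
      reval f (cons_tuple y v) 0 /\
      forall z, z < y -> exists t, reval f (cons_tuple z v) t.+1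
  end.

Definition computable2 (F : nat -> nat -> nat) : Prop :=
  exists c : recfun 2, forall m n, reval c [tuple m; n] (F m n).

Definition recursive_set2 (A : set (nat * nat)) : Prop :=
  computable2 (fun m n => nat_of_bool `[< A (m, n) >]).

Definition least (P : set nat) : nat :=
  if pselect (exists k, `[< P k >]) is left h then ex_minn h else 0.

Section Presentations.
Variable X : finType.

Local Notation word := (seq X).

(* Goedel numbering of words: bijective base-#|X| numeration, the letters being
   the digits 1, ..., #|X|.  The empty word is coded by 0. *)
Definition word_code (w : word) : nat :=
  foldl (fun c x => c * #|X| + (enum_rank x).+1) 0 w.

Definition decidable_words2 (E : set (word * word)) : Prop :=
  recursive_set2 [set (word_code p.1, word_code p.2) | p in E].

Variable R : set (word * word).

Definition symmetric_rels : Prop := forall u v, R (u, v) -> R (v, u).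

Definition congruence (E : set (word * word)) : Prop :=
  [/\ forall u, E (u, u),
      forall u v, E (u, v) -> E (v, u),
      forall u v w, E (u, v) -> E (v, w) -> E (u, w) &
      forall u u' v v', E (u, u') -> E (v, v') -> E (u ++ v, u' ++ v')].

Definition relations : set (word * word) := smallest congruence R.

Definition solvable_word_problem : Prop := decidable_words2 relations.

Definition one_step (r : word * word) (u v : word) : Prop :=
  exists x y, u = x ++ r.1 ++ y /\ v = x ++ r.2 ++ y.

(* The derivation (u, u_1, ..., u_k) is represented by its starting word [u] and
   the sequence of the pairs (r_i, u_i), where r_i is the defining relation by
   means of which the i-th step is made. *)
Fixpoint derivation (u : word) (s : seq ((word * word) * word)) : Prop :=
  if s is (r, w) :: s' then [/\ R r, one_step r u w & derivation w s']
  else True.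

Definition derivation_from_to u v s : Prop :=
  derivation u s /\ last u [seq p.2 | p <- s] = v.

Definition derivation_work (s : seq ((word * word) * word)) : nat :=
  \sum_(p <- s) (size p.1.1 + size p.1.2).

(* [dl] and [work] are meaningful on relations only, and when [R] is symmetric:
   the set of derivations is then non-empty. *)
Definition dl (u v : word) : nat :=
  least [set size s | s in derivation_from_to u v].

Definition work (u v : word) : nat :=
  least [set derivation_work s | s in derivation_from_to u v].

(* [n.-bseq X] is the finite type of the words of length at most [n]; the
   maxima below range over non-empty sets, as (1, 1) is a relation. *)
Definition DL (n1 n2 : nat) : nat :=
  \max_(p : n1.-bseq X * n2.-bseq X
         | `[< relations (val p.1, val p.2) >]) dl (val p.1) (val p.2).

Definition Omega (n1 n2 : nat) : nat :=
  \max_(p : n1.-bseq X * n2.-bseq X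
         | `[< relations (val p.1, val p.2) >]) work (val p.1) (val p.2).

End Presentations.

Definition computably_bounded (F : nat -> nat -> nat) : Prop :=
  exists2 B, computable2 B & forall n1 n2, F n1 n2 <= B n1 n2.

(* Main.v *)
Require Import Defs.
From mathcomp Require Import all_boot.
From mathcomp Require Import zify.
From mathcomp Require Import boolp classical_sets cardinality.

Set Implicit Arguments.
Unset Strict Implicit.
Unset Printing Implicit Defensive.

(* Both parts are instances of one statement about derivations weighted by a
   computable cost [kappa] of the defining relations such that
   [|a| + |b| <= M * kappa (a, b)]: take [kappa (a, b) = |a| + |b|] and [M = 1]
   for the work, and [kappa = 1] and [M] the maximal size of a relation for the
   length.  All words of a derivation of cost at most [k] starting from [u] have
   length at most [|u| + M * k], so that "there is a derivation of cost at most
   [k] from [u] to [v]" is a reachability problem in a finite graph, hence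
   decidable.  Given a computable bound on the costs this decides the word
   problem; conversely, if the word problem is decidable, the maximal cost is
   found by minimization, as the least [k] such that all related pairs of short
   words are joined by a derivation of cost at most [k]. *)

(** * Recursive functions of a context *)

(** A function of a tuple is a term in a context: the entry of index 0 is the innermost bound
    variable. The code has to be defined on every tuple, so only total functions qualify. *)
Definition recursive n (f : n.-tuple nat -> nat) : Prop :=
  exists c : recfun n, forall v, reval c v (f v).

Lemma eq_recursive n (f g : n.-tuple nat -> nat) :
  f =1 g -> recursive f -> recursive g.
Proof. by move=> fg [c fc]; exists c => v; rewrite -fg. Qed.

Lemma recursive_comp m n (f : m.-tuple nat -> nat)
    (g : 'I_m -> n.-tuple nat -> nat) :
  recursive f -> (forall i, recursive (g i)) ->
  recursive (fun v => f [tuple g i v | i < m]).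
Proof.
move=> [c fc] gP; have [d dP] := choice gP.
exists (RComp c d) => v; exists [tuple g i v | i < m] => //= i.
by rewrite tnth_mktuple; apply: dP.
Qed.

Lemma recursive_tnth n (i : 'I_n) : recursive (fun v => tnth v i).
Proof. by exists (RProj i). Qed.

Lemma recursive_thead n : recursive (@thead n nat).
Proof. exact: recursive_tnth ord0. Qed.

Lemma recursive_behead n (f : n.-tuple nat -> nat) :
  recursive f -> recursive (fun v : n.+1.-tuple nat => f (behead_tuple v)).
Proof.
move=> fP; have := recursive_comp fP (fun i => recursive_tnth (lift ord0 i)).
apply: eq_recursive => v; congr f; apply: eq_from_tnth => i.
rewrite tnth_mktuple tnth_behead; congr tnth.
by apply: val_inj; rewrite /= inordK ?ltnS.
Qed.

(** Composition with [b] followed by the projections. Closure under an operation thus has to be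
    checked only when its distinguished argument is the head variable. *)
Lemma recursive_subst n (F : nat -> n.-tuple nat -> nat) b :
  recursive (fun v : n.+1.-tuple nat => F (thead v) (behead_tuple v)) ->
  recursive b -> recursive (fun v => F (b v) v).
Proof.
move=> FP bP.
pose g (i : 'I_n.+1) v := if unlift ord0 i is Some j then tnth v j else b v.
have gP i : recursive (g i).
  rewrite /g; case: (unlift _ _) => [j|]; last exact: bP.
  exact: recursive_tnth.
apply: eq_recursive (recursive_comp FP gP) => v.
congr F; first by rewrite /thead tnth_mktuple /g unlift_none.
apply: eq_from_tnth => i; rewrite tnth_behead tnth_mktuple /g.
rewrite (_ : inord _ = lift ord0 i) ?liftK //.
by apply: val_inj; rewrite /= inordK // ltnS.
Qed.

Lemma recursive_succ n (f : n.-tuple nat -> nat) :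
  recursive f -> recursive (fun v => (f v).+1).
Proof.
move=> fP; apply: (@recursive_subst n (fun k _ => k.+1) f) fP.
exists (RComp RSucc (fun=> RProj ord0)) => v; exists [tuple thead v] => //= i.
by rewrite (ord1 i).
Qed.

Lemma recursive_const n k : recursive (fun _ : n.-tuple nat => k).
Proof.
elim: k => [|k]; last exact: recursive_succ.
apply: (@recursive_comp 0 n (fun=> 0) (fun _ _ => 0)) => [|[]//].
by exists RZero.
Qed.

Lemma recursive_prec n (F : nat -> n.-tuple nat -> nat)
    (G : nat -> nat -> n.-tuple nat -> nat) b :
  recursive (F 0) ->
  recursive (fun v : n.+2.-tuple nat =>
    G (thead v) (thead (behead_tuple v)) (behead_tuple (behead_tuple v))) ->
  (forall k v, F k.+1 v = G k (F k v) v) ->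
  recursive b -> recursive (fun v => F (b v) v).
Proof.
move=> [c0 c0P] [c cP] FS; apply: recursive_subst.
exists (RPrec c0 c) => v /=; elim: (thead v) => [|k IH]; first exact: c0P.
exists (F k (behead_tuple v)) => //; rewrite FS.
set w := cons_tuple _ _; have := cP w.
rewrite (_ : behead_tuple (behead_tuple w) = behead_tuple v) //.
exact: val_inj.
Qed.

Lemma recursive_least n (f : nat -> n.-tuple nat -> nat)
    (g : n.-tuple nat -> nat) :
  recursive (fun v : n.+1.-tuple nat => f (thead v) (behead_tuple v)) ->
  (forall v, f (g v) v = 0 /\ forall z, z < g v -> 0 < f z v) -> recursive g.
Proof.
move=> [c cP] gP; exists (RMu c) => v /=; have [g0 gmin] := gP v.
have consE z : reval c (cons_tuple z v) (f z v).
  have := cP (cons_tuple z v).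
  by rewrite (_ : behead_tuple (cons_tuple z v) = v) //; apply: val_inj.
(* [RMu] requires a successor value at each [z] below the minimum; positivity of [f z v] provides
   it. *)
split=> [|z /gmin fz]; first by rewrite -g0.
by exists (f z v).-1; rewrite prednK.
Qed.

Lemma computable2P (F : nat -> nat -> nat) :
  computable2 F <->
  recursive (fun v : 2.-tuple nat => F (thead v) (thead (behead_tuple v))).
Proof.
split=> [] [c cP]; exists c; last by move=> m n; apply: (cP [tuple m; n]).
move=> v; rewrite {1}(_ : v = [tuple thead v; thead (behead_tuple v)]) //.
by case: v => [[|x [|y []]] //] sz; apply: val_inj.
Qed.

Lemma recursive_app2 n (F : nat -> nat -> nat) (f g : n.-tuple nat -> nat) :
  computable2 F -> recursive f -> recursive g ->
  recursive (fun v => F (f v) (g v)).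
Proof.
move=> /computable2P FP fP gP.
pose h (i : 'I_2) := if i == ord0 then f else g.
have hP i : recursive (h i) by rewrite /h; case: ifP.
apply: eq_recursive (recursive_comp FP hP) => v.
by rewrite /thead tnth_behead !tnth_mktuple /h /= -val_eqE /= inordK.
Qed.

(** In the step of a primitive recursion the previous value stands between the counter and the
    parameters; a summand depending only on these has to skip it. *)
Lemma recursive_weaken2 n (F : nat -> n.-tuple nat -> nat) :
  recursive (fun v : n.+1.-tuple nat => F (thead v) (behead_tuple v)) ->
  recursive (fun v : n.+2.-tuple nat =>
    F (thead v) (behead_tuple (behead_tuple v))).
Proof.
move=> FP.
pose g (i : 'I_n.+1) (v : n.+2.-tuple nat) :=
  if unlift ord0 i is Some j then tnth v (lift ord0 (lift ord0 j)) else thead v.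
have gP i : recursive (g i).
  by rewrite /g; case: (unlift _ _) => [j|]; apply: recursive_tnth.
apply: eq_recursive (recursive_comp FP gP) => v.
congr F; first by rewrite /thead tnth_mktuple /g unlift_none.
have inordS m (i : 'I_m) : inord i.+1 = lift ord0 i.
  by apply: val_inj; rewrite /= inordK // ltnS.
apply: eq_from_tnth => i.
by rewrite !tnth_behead tnth_mktuple !inordS /g liftK.
Qed.

(** Weakens [h] by up to [k] variables. The value 5 used below is the nesting depth of the
    quantifiers in [step_closed]. *)
Ltac recursive_shift k h :=
  first [ refine h
        | lazymatch k with S ?k' =>
            recursive_shift k' uconstr:(recursive_behead h)
          end ].

Ltac recursive_var :=
  match goal with
  | H : recursive _ |- _ => recursive_shift 5 H
  | |- _ => first [ exact: recursive_const
                  | recursive_shift 5 uconstr:(@recursive_thead _) ]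
  end.

(** * Closure under arithmetic, connectives and bounded quantifiers *)

Lemma recursive_add n (f g : n.-tuple nat -> nat) :
  recursive f -> recursive g -> recursive (fun v => f v + g v).
Proof.
move=> fP gP.
apply: (@recursive_prec n (fun k v => k + g v) (fun _ z _ => z.+1)) fP => //.
by apply: recursive_succ; recursive_var.
Qed.

Lemma recursive_sub n (f g : n.-tuple nat -> nat) :
  recursive f -> recursive g -> recursive (fun v => f v - g v).
Proof.
move=> fP gP.
apply: (@recursive_prec n (fun k v => f v - k) (fun _ z _ => z.-1)) gP.
- by apply: eq_recursive fP => v; rewrite subn0.
- apply: (@recursive_prec n.+2 (fun k _ => k.-1) (fun k _ _ => k)) => //;
    by recursive_var.
- by move=> k v; rewrite subnS.
Qed.

Lemma recursive_sum n (F : nat -> n.-tuple nat -> nat) b :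
  recursive (fun v : n.+1.-tuple nat => F (thead v) (behead_tuple v)) ->
  recursive b -> recursive (fun v => \sum_(0 <= i < b v) F i v).
Proof.
move=> FP bP.
apply: (@recursive_prec n (fun k v => \sum_(0 <= i < k) F i v)
  (fun k z v => z + F k v)) bP.
- by apply: eq_recursive (recursive_const n 0) => v; rewrite big_geq.
- by apply: recursive_add; [recursive_var | apply: recursive_weaken2].
- by move=> k v; rewrite big_nat_recr.
Qed.

Lemma recursive_mul n (f g : n.-tuple nat -> nat) :
  recursive f -> recursive g -> recursive (fun v => f v * g v).
Proof.
move=> fP gP.
apply: (@recursive_prec n (fun k v => k * g v) (fun _ z v => g v + z)) fP => //.
  exact: (recursive_const _ 0).
by apply: recursive_add; recursive_var.
Qed.

Lemma recursive_expn n (f g : n.-tuple nat -> nat) :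
  recursive f -> recursive g -> recursive (fun v => f v ^ g v).
Proof.
move=> fP gP.
apply: (@recursive_prec n (fun k v => f v ^ k) (fun _ z v => f v * z)) gP.
- by recursive_var.
- by apply: recursive_mul; recursive_var.
- by move=> k v; rewrite expnS.
Qed.

Lemma recursive_leq n (f g : n.-tuple nat -> nat) :
  recursive f -> recursive g -> recursive (fun v => f v <= g v).
Proof.
move=> fP gP; apply: (@eq_recursive _ (fun v => 1 - (f v - g v))).
  by move=> v; rewrite /leq; case: (f v - g v).
by apply/recursive_sub/recursive_sub => //; apply: recursive_const.
Qed.

Lemma recursive_neg n (p : n.-tuple nat -> bool) :
  recursive p -> recursive (fun v => ~~ p v).
Proof.
move=> pP; apply: (@eq_recursive _ (fun v => 1 - p v)).
  by move=> v; case: (p v).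
by apply: recursive_sub => //; apply: recursive_const.
Qed.

Lemma recursive_and n (p q : n.-tuple nat -> bool) :
  recursive p -> recursive q -> recursive (fun v => p v && q v).
Proof.
move=> pP qP; apply: (@eq_recursive _ (fun v => p v * q v)).
  by move=> v; rewrite mulnb.
exact: recursive_mul.
Qed.

Lemma recursive_imply n (p q : n.-tuple nat -> bool) :
  recursive p -> recursive q -> recursive (fun v => p v ==> q v).
Proof.
move=> pP qP; apply: (@eq_recursive _ (fun v => ~~ (p v && ~~ q v))).
  by move=> v; case: (p v) (q v) => [] [].
by apply/recursive_neg/recursive_and/recursive_neg.
Qed.

Lemma recursive_all n (P : nat -> n.-tuple nat -> bool) b :
  recursive (fun v : n.+1.-tuple nat => P (thead v) (behead_tuple v)) ->
  recursive b -> recursive (fun v => all (P^~ v) (iota 0 (b v))).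
Proof.
move=> PP bP.
(* A bounded universal quantifier holds when the number of counterexamples is 0. *)
apply: (@eq_recursive _ (fun v => \sum_(0 <= i < b v) ~~ P i v <= 0)).
  move=> v; rewrite leqn0 -[X in iota _ X]subn0 -/(index_iota 0 (b v)).
  elim: (index_iota _ _) => [|i s IH]; first by rewrite big_nil.
  by rewrite big_cons addn_eq0 /=; case: (P i v).
apply/recursive_leq/recursive_const; apply: recursive_sum bP.
exact: recursive_neg.
Qed.

Lemma recursive_has n (P : nat -> n.-tuple nat -> bool) b :
  recursive (fun v : n.+1.-tuple nat => P (thead v) (behead_tuple v)) ->
  recursive b -> recursive (fun v => has (P^~ v) (iota 0 (b v))).
Proof.
move=> PP bP.
apply: (@eq_recursive _ (fun v => ~~ all (fun i => ~~ P i v) (iota 0 (b v)))).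
  by move=> v; rewrite -has_predC; congr nat_of_bool; apply: eq_has => i /=;
    rewrite negbK.
apply: recursive_neg; apply: recursive_all bP; exact: recursive_neg.
Qed.

Lemma recursive_odd n (f : n.-tuple nat -> nat) :
  recursive f -> recursive (fun v => odd (f v)).
Proof.
apply: (@recursive_prec n (fun k _ => odd k) (fun _ z _ => 1 - z)).
- exact: recursive_const.
- by apply: recursive_sub; recursive_var.
- by move=> k _; rewrite /=; case: odd.
Qed.

Lemma sum_ltn m d : \sum_(0 <= i < m) (i < d) = minn m d.
Proof.
elim: m => [|m IH]; first by rewrite big_geq ?min0n.
rewrite big_nat_recr //= {}IH; case: (ltnP m d) => md.
  by rewrite (minn_idPl md) addn1.
by rewrite (minn_idPr (leqW md)) addn0.
Qed.

(** For positive [g], the quotient is the number of [i] with [i.+1 * g <= f], and all such [i] are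
    below [f]. *)
Lemma recursive_div n (f g : n.-tuple nat -> nat) :
  recursive f -> recursive g -> (forall v, 0 < g v) ->
  recursive (fun v => f v %/ g v).
Proof.
move=> fP gP g0.
apply: (@eq_recursive _ (fun v => \sum_(0 <= i < f v) (i.+1 * g v <= f v))).
  move=> v; under eq_bigr do rewrite -leq_divRL //.
  by rewrite sum_ltn; apply/minn_idPr/leq_div.
apply: recursive_sum (fP); apply: recursive_leq; last by recursive_var.
apply: recursive_mul; last by recursive_var.
by apply: recursive_succ; recursive_var.
Qed.

(** Applies the closure lemma of the outermost operation, extending the context under binders, and
    leaves uncovered goals to the user. [recursive_extra] is a hook, redefined once the operations
    on codes are available. *)
Ltac recursivity := cbv beta;
  lazymatch goal with
  | |- recursive (fun v => @?f v + @?g v) =>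
      refine (recursive_add (f := f) (g := g) _ _); recursivity
  | |- recursive (fun v => @?f v - @?g v) =>
      refine (recursive_sub (f := f) (g := g) _ _); recursivity
  | |- recursive (fun v => @?f v * @?g v) =>
      refine (recursive_mul (f := f) (g := g) _ _); recursivity
  | |- recursive (fun v => @?f v ^ @?g v) =>
      refine (recursive_expn (f := f) (g := g) _ _); recursivity
  | |- recursive (fun v => @?f v %/ @?g v) =>
      refine (recursive_div (f := f) (g := g) _ _ _); recursivity
  | |- recursive (fun v => \sum_(0 <= i < @?b v) @?F v i) =>
      refine (recursive_sum (F := fun i v => F v i) (b := b) _ _); recursivity
  | |- recursive (fun v => nat_of_bool (@?f v <= @?g v)) =>
      refine (recursive_leq (f := f) (g := g) _ _); recursivity
  | |- recursive (fun v => nat_of_bool (~~ @?f v)) =>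
      refine (recursive_neg (p := f) _); recursivity
  | |- recursive (fun v => nat_of_bool (@?f v && @?g v)) =>
      refine (recursive_and (p := f) (q := g) _ _); recursivity
  | |- recursive (fun v => nat_of_bool (@?f v ==> @?g v)) =>
      refine (recursive_imply (p := f) (q := g) _ _); recursivity
  | |- recursive (fun v => nat_of_bool (odd (@?f v))) =>
      refine (recursive_odd (f := f) _); recursivity
  | |- recursive (fun v => nat_of_bool (all (fun i => @?P v i) (iota 0 (@?b v)))) =>
      refine (recursive_all (P := fun i v => P v i) (b := b) _ _); recursivity
  | |- recursive (fun v => nat_of_bool (has (fun i => @?P v i) (iota 0 (@?b v)))) =>
      refine (recursive_has (P := fun i v => P v i) (b := b) _ _); recursivity
  | |- recursive (fun v => S (@?f v)) =>
      refine (recursive_succ (f := f) _); recursivity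
  | |- _ => first [recursive_var | recursive_extra | idtac]
  end
with recursive_extra := fail.

(** * Bit masks and arithmetic of word codes *)

Definition testbit S i := odd (S %/ 2 ^ i).

Lemma recursive_testbit n (f g : n.-tuple nat -> nat) :
  recursive f -> recursive g -> recursive (fun v => testbit (f v) (g v)).
Proof.
by move=> fP gP; rewrite /testbit; recursivity => v; rewrite expn_gt0.
Qed.

(* The number of words of length at most [l] on [q] letters; the codes of these
   words are exactly the numbers below [geo q l], even if [q = 0]. *)
Definition geo q l := \sum_(0 <= i < l.+1) q ^ i.

Lemma recursive_geo q n (f : n.-tuple nat -> nat) :
  recursive f -> recursive (fun v => geo q (f v)).
Proof. by move=> fP; rewrite /geo; recursivity. Qed.

(** The length of the word with code [c]: the [l] with [geo q l <= c] are those smaller than that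
    length. The range [l < c] suffices because a word is no longer than its code. *)
Definition code_size q c := \sum_(0 <= l < c) (geo q l <= c).

Lemma recursive_code_size q n (f : n.-tuple nat -> nat) :
  recursive f -> recursive (fun v => code_size q (f v)).
Proof.
move=> fP; rewrite /code_size; recursivity.
by apply: recursive_geo; recursivity.
Qed.

(** Concatenation shifts the code of the left factor by as many base-[q] digits as the right factor
    has letters. *)
Definition code_cat q a b := a * q ^ code_size q b + b.

Lemma recursive_code_cat q n (f g : n.-tuple nat -> nat) :
  recursive f -> recursive g -> recursive (fun v => code_cat q (f v) (g v)).
Proof.
move=> fP gP; rewrite /code_cat; recursivity.
exact: recursive_code_size.
Qed.

Ltac recursive_extra ::=
  first [ apply: recursive_testbit | apply: recursive_geo
        | apply: recursive_code_size | apply: recursive_code_cat ]; recursivity.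

(** * Search for a derivation of bounded cost *)

Section CostSearch.
Variables (q M : nat) (chi kap : nat -> nat -> nat).

(* [S] is the bit mask of a set of states, the state (w, j) meaning that the
   word [w] is reached at cost [j <= k]; its index is [word_code w * k.+1 + j]. *)
Definition step_closed N k S :=
  all (fun x => all (fun y => all (fun a => all (fun b => all (fun j =>
    (0 < chi a b) && (code_cat q x (code_cat q b y) < N) && (j + kap a b <= k)
      && testbit S (code_cat q x (code_cat q a y) * k.+1 + j)
    ==> testbit S (code_cat q x (code_cat q b y) * k.+1 + (j + kap a b)))
  (iota 0 k.+1)) (iota 0 N)) (iota 0 N)) (iota 0 N)) (iota 0 N).

(* Reachability without recursion: [v] lies in every closed set containing
   the initial state (u, 0). *)
Definition cost_le u v k :=
  all (fun S =>
    testbit S (u * k.+1) && step_closed (geo q (code_size q u + M * k)) k S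
    ==> has (fun j => testbit S (v * k.+1 + j)) (iota 0 k.+1))
  (iota 0 (2 ^ (geo q (code_size q u + M * k) * k.+1))).

Hypotheses (chiP : computable2 chi) (kapP : computable2 kap).

Lemma recursive_step_closed n (f g h : n.-tuple nat -> nat) :
  recursive f -> recursive g -> recursive h ->
  recursive (fun v => step_closed (f v) (g v) (h v)).
Proof.
move=> fP gP hP; rewrite /step_closed; recursivity.
- by apply: (recursive_app2 chiP); recursivity.
- by apply: (recursive_app2 kapP); recursivity.
- by apply: (recursive_app2 kapP); recursivity.
Qed.

Lemma recursive_cost_le n (f g h : n.-tuple nat -> nat) :
  recursive f -> recursive g -> recursive h ->
  recursive (fun v => cost_le (f v) (g v) (h v)).
Proof.
move=> fP gP hP; rewrite /cost_le; recursivity.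
by apply: recursive_step_closed; recursivity.
Qed.

End CostSearch.

Lemma all_iotaP (P : pred nat) n :
  reflect (forall i, i < n -> P i) (all P (iota 0 n)).
Proof.
apply: (iffP (@allP _ P _)) => H i; last by rewrite mem_iota; apply: H.
by move=> ilt; apply: H; rewrite mem_iota.
Qed.

Lemma has_iotaP (P : pred nat) n :
  reflect (exists2 i, i < n & P i) (has P (iota 0 n)).
Proof.
by apply: (iffP (@hasP _ P _)) => -[i]; rewrite ?mem_iota => ? ?;
  exists i; rewrite ?mem_iota.
Qed.

(** * Words and their codes *)

Lemma testbitDl S K (b : bool) i :
  S < 2 ^ K -> testbit (S + b * 2 ^ K) i = if i == K then b else testbit S i.
Proof.
rewrite /testbit => SK; case: (ltngtP i K) => [iK|Ki|->].
(* Below position [K], the added term is an even multiple of [2 ^ i] and does not change the parity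
   of the quotient. *)
- have -> : S + b * 2 ^ K = b * 2 ^ (K - i.+1) * 2 * 2 ^ i + S.
    by rewrite -!mulnA -expnS -expnD subnK // addnC.
  by rewrite divnMDl ?expn_gt0 // oddD oddM andbF.
- rewrite !divn_small //; first exact: leq_trans SK (leq_pexp2l _ (ltnW Ki)).
  apply: leq_trans (_ : 2 ^ K.+1 <= _); last by rewrite leq_exp2l.
  rewrite expnS mul2n -addnn; case: b; rewrite ?mul1n ?mul0n ?ltn_add2r //.
  by rewrite addn0 ltn_addr.
- by rewrite divnDMl ?expn_gt0 // divn_small // oddb.
Qed.

Lemma testbit_ex (A : pred nat) K :
  exists2 S, S < 2 ^ K & forall i, testbit S i = (i < K) && A i.
Proof.
elim: K => [|K [S SK SP]]; first by exists 0 => // i; rewrite /testbit div0n.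
exists (S + A K * 2 ^ K).
  rewrite expnS mul2n -addnn; case: (A K); rewrite ?mul1n ?mul0n ?ltn_add2r //.
  by rewrite addn0 ltn_addr.
by move=> i; rewrite testbitDl // SP ltnS; case: ltngtP => //= ->.
Qed.

Section WordCodes.
Variable X : finType.
Local Notation q := #|X|.
Implicit Types (u v w : seq X).

Lemma word_code_rcons w x :
  word_code (rcons w x) = word_code w * q + (enum_rank x).+1.
Proof. by rewrite /word_code foldl_rcons. Qed.

Lemma word_code_cat u v :
  word_code (u ++ v) = word_code u * q ^ size v + word_code v.
Proof.
elim/last_ind: v => [|v x IH]; first by rewrite cats0 muln1 addn0.
by rewrite -rcons_cat !word_code_rcons IH size_rcons expnSr mulnDl mulnA addnA.
Qed.

Lemma geoS l : geo q l.+1 = (geo q l * q).+1.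
Proof.
rewrite /geo big_nat_recl //= big_distrl /= add1n.
by congr S; apply: eq_bigr => i _; rewrite expnSr.
Qed.

Lemma geo0 : geo q 0 = 1.
Proof. by rewrite /geo big_nat1. Qed.

(** Once the successors cancel, the quotient by [q] is the code of the word without its last letter,
    and the remainder is the rank of that letter. *)
Lemma word_code_inj : injective (@word_code X).
Proof.
elim/last_ind => [|u x IH] v; elim/last_ind: v => [|v y _] //;
  rewrite ?word_code_rcons ?addnS // => -[uv].
have q0 : 0 < q by apply/card_gt0P; exists x.
have := congr1 (fun n => n %/ q) uv; rewrite !divnMDl // !divn_small // !addn0.
move=> /IH ->; congr rcons; apply/enum_rank_inj/val_inj.
by have := congr1 (fun n => n %% q) uv; rewrite !modnMDl !modn_small.
Qed.

(** The successor in the last digit cancels the one in [geoS]; dividing by [q] then drops the last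
    letter and lowers [l] by one. *)
Lemma word_code_lt l w : (word_code w < geo q l) = (size w <= l).
Proof.
elim/last_ind: w l => [|w x IH] [|l]; rewrite ?geo0 ?geoS //.
  by rewrite word_code_rcons addnS ltnS ltn0 size_rcons.
have q0 : 0 < q by apply/card_gt0P; exists x.
rewrite word_code_rcons addnS !ltnS size_rcons ltnS -IH.
by rewrite -ltn_divLR // divnMDl // divn_small // addn0.
Qed.

Lemma leq_size_code w : size w <= word_code w.
Proof.
elim/last_ind: w => [|w x IH] //; rewrite word_code_rcons size_rcons addnS ltnS.
have q0 : 0 < q by apply/card_gt0P; exists x.
by apply: leq_trans (leq_addr _ _); apply: leq_trans IH (leq_pmulr _ _).
Qed.

Lemma code_size_word w : code_size q (word_code w) = size w.
Proof.
rewrite /code_size; under eq_bigr do rewrite leqNgt word_code_lt -ltnNge.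
by rewrite sum_ltn; apply/minn_idPr/leq_size_code.
Qed.

Lemma code_cat_word u v :
  code_cat q (word_code u) (word_code v) = word_code (u ++ v).
Proof. by rewrite /code_cat code_size_word word_code_cat. Qed.

Lemma word_code_surj l c :
  c < geo q l -> exists2 w : seq X, word_code w = c & size w <= l.
Proof.
suff H : c < geo q l -> exists w : seq X, word_code w = c.
  by move=> cl; have [w wc] := H cl; exists w => //; rewrite -word_code_lt wc.
elim: l c => [|l IH] [|c]; rewrite ?geo0 ?geoS //; try by exists [::].
(* A nonzero code below [geo q l.+1] forces the alphabet to be non-empty. The digits being 1 to [q],
   it is the predecessor [c] of the code that is divided by [q]. *)
rewrite ltnS => cl; have q0 : 0 < q by move: cl; case: (q) => //; rewrite muln0.
have [|w wc] := IH (c %/ q); first by rewrite ltn_divLR.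
exists (rcons w (enum_val (Ordinal (ltn_pmod c q0)))).
by rewrite word_code_rcons enum_valK wc /= addnS -divn_eq.
Qed.

Lemma decidable_words2_code (E : set (seq X * seq X)) u v :
  `[< [set (word_code p.1, word_code p.2) | p in E]%classic
      (word_code u, word_code v) >]
  = `[< E (u, v) >].
Proof.
apply/asboolP/asboolP => [[[a b] Eab /=]|]; last by exists (u, v).
by move=> [/word_code_inj <- /word_code_inj <-].
Qed.

End WordCodes.

(** * Derivations *)

Section Derivations.
Variables (X : finType) (R : set (seq X * seq X)).
Implicit Types (u v w : seq X) (s : seq ((seq X * seq X) * seq X)).

Definition derives u v := exists s, derivation_from_to R u v s.

Lemma derivation_cat u s1 s2 :
  derivation R u (s1 ++ s2) <->
  derivation R u s1 /\ derivation R (last u [seq p.2 | p <- s1]) s2.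
Proof.
elim: s1 u => [|[r w] s1 IH] u /=; first by split=> [|[]].
split=> [[Rr uw /IH[]]|[[Rr uw ?] ?]] //.
by split=> //; apply/IH.
Qed.

Lemma derives_refl u : derives u u.
Proof. by exists [::]. Qed.

Lemma derives_trans u v w : derives u v -> derives v w -> derives u w.
Proof.
move=> [s1 [d1 l1]] [s2 [d2 l2]]; exists (s1 ++ s2); split.
  by apply/derivation_cat; rewrite l1.
by rewrite map_cat last_cat l1.
Qed.

Lemma derives_step r u v : R r -> one_step r u v -> derives u v.
Proof. by move=> Rr uv; exists [:: (r, v)]. Qed.

Lemma derives_cat u1 u2 v w :
  derives u1 u2 -> derives (v ++ u1 ++ w) (v ++ u2 ++ w).
Proof.
move=> [s [ds ls]]; elim: s u1 ds ls => [|[r u] s IH] u1 /=.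
  by move=> _ ->; apply: derives_refl.
move=> [Rr [x [y [-> uE]]] ds] ls; apply: derives_trans (IH _ ds ls).
apply: (derives_step Rr); exists (v ++ x), (y ++ w).
by rewrite uE -!catA.
Qed.

Hypothesis hsym : symmetric_rels R.

Lemma derives_sym u v : derives u v -> derives v u.
Proof.
move=> [s [ds ls]]; elim: s u ds ls => [|[[a b] w] s IH] u /=.
  by move=> _ ->; apply: derives_refl.
move=> [Rr [x [y [uE wE]]] ds] ls; apply: derives_trans (IH _ ds ls) _.
by apply: (derives_step (hsym Rr)); exists x, y.
Qed.

(** Derivability is a congruence containing [R], its symmetry coming from that of [R]; conversely,
    each step lies in every congruence containing [R]. *)
Lemma relationsP u v : relations R (u, v) <-> derives u v.
Proof.
split.
  suff sub : (relations R `<=` [set p | derives p.1 p.2])%classic by apply: sub.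
  apply: smallest_sub => [|[a b] Rab /=]; last first.
    by apply: (derives_step Rab); exists [::], [::]; rewrite /= !cats0.
  split=> /=; [exact: derives_refl|exact: derives_sym|exact: derives_trans|].
  (* The left factor is rewritten first, then the right one. *)
  move=> u1 u2 v1 v2 d1 d2; apply: (@derives_trans _ (u2 ++ v1)).
    exact: (derives_cat [::]).
  by have := derives_cat u2 [::] d2; rewrite !cats0.
move=> [s [ds ls]] E [[Er _ Et Ec] RE].
elim: s u ds ls => [|[[a b] w] s IH] u /=; first by move=> _ ->.
move=> [Rr [x [y [-> wE]]] ds] ls; apply: Et (IH _ ds ls); rewrite wE.
by apply: (Ec); rewrite //; apply: Ec => //; apply: RE.
Qed.

End Derivations.

(** * Correctness of the cost-bounded search *)

Section Cost.
Variables (X : finType) (R : set (seq X * seq X)).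
Variable kappa : seq X * seq X -> nat.
Implicit Types (u v w : seq X) (s : seq ((seq X * seq X) * seq X)).
Local Notation q := #|X|.

Definition cost s := \sum_(p <- s) kappa p.1.

Variables (M : nat) (chi kap : nat -> nat -> nat).
Hypothesis chiE : forall u v, chi (word_code u) (word_code v) = `[< R (u, v) >].
Hypothesis kapE : forall u v, kap (word_code u) (word_code v) = kappa (u, v).
Hypothesis size_le_kappa : forall r, R r -> size r.1 + size r.2 <= M * kappa r.

Lemma state_inj k u v i j : i <= k -> j <= k ->
  word_code u * k.+1 + i = word_code v * k.+1 + j -> u = v /\ i = j.
Proof.
move=> ik jk E; split.
  apply: word_code_inj; have := congr1 (fun n => n %/ k.+1) E.
  by rewrite /= !divnMDl // !divn_small // !addn0.
by have := congr1 (fun n => n %% k.+1) E; rewrite /= !modnMDl !modn_small.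
Qed.

(** If the test succeeds, it applies to the mask of the states actually reached by derivations,
    which is closed, so [v] is reached. Conversely, a derivation of cost at most [k] is followed
    step by step inside any closed set. *)
Lemma cost_leP u v k :
  cost_le q M chi kap (word_code u) (word_code v) k <->
  exists2 s, derivation_from_to R u v s & cost s <= k.
Proof.
rewrite /cost_le code_size_word; set N := geo q _; split.
- move=> /all_iotaP H.
  pose A i := `[< exists w s, [/\ derivation_from_to R u w s, cost s <= k
                                & i = word_code w * k.+1 + cost s] >].
  have [S SK SP] := testbit_ex A (N * k.+1).
  have {H} /implyP := H S SK.
  have cl : step_closed q chi kap N k S.
    apply/all_iotaP => x xN; apply/all_iotaP => y yN; apply/all_iotaP => a aN.
    apply/all_iotaP => b bN; apply/all_iotaP => j; rewrite ltnS => jk.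
    have [x' <- _] := word_code_surj xN.
    have [y' <- _] := word_code_surj yN.
    have [a' <- _] := word_code_surj aN.
    have [b' <- _] := word_code_surj bN.
    rewrite !code_cat_word chiE kapE !SP lt0b; apply/implyP.
    move=> /andP[/andP[/andP[/asboolP Rab bN'] jk'] /andP[_ /asboolP]].
    move=> [w [s [[ds ls] sk /(state_inj jk sk)[wE jE]]]].
    have jS : j + kappa (a', b') < k.+1 by [].
    (* The new index lies in the range of the mask exactly when the new word has code below [N],
       which is a guard of [step_closed]. *)
    rewrite -ltn_divLR // divnMDl // divn_small // addn0 bN' /=; apply/asboolP.
    exists (x' ++ b' ++ y'), (rcons s ((a', b'), x' ++ b' ++ y')).
    rewrite {1 2}/cost -cats1 big_cat big_seq1 -/(cost s) /= -jE; split=> //.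
    split; last by rewrite map_cat last_cat.
    by apply/derivation_cat; rewrite ls -wE; split=> //; split=> //;
      exists x', y'.
  rewrite cl andbT SP => /(_ _)/has_iotaP[].
    apply/andP; split.
      by rewrite ltn_pmul2r // word_code_lt leq_addr.
    by apply/asboolP; exists u, [::]; rewrite /cost big_nil addn0.
  move=> j; rewrite ltnS => jk; rewrite SP => /andP[_ /asboolP].
  move=> [w [s [ds sk /(state_inj jk sk)[-> _]]]]; by exists s.
- move=> [s [ds ls] sk]; apply/all_iotaP => S _; apply/implyP.
  move=> /andP[S0 /all_iotaP cl].
  (* The invariant combines the current length with [M] times the remaining cost. A step by [(a, b)]
     lengthens the word by at most [M * kappa (a, b)], so all words met keep their codes below
     [N]. *)
  suff H t w j : derivation R w t -> last w [seq p.2 | p <- t] = v ->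
      j + cost t <= k -> size w + M * cost t <= size u + M * k ->
      testbit S (word_code w * k.+1 + j) ->
      testbit S (word_code v * k.+1 + (j + cost t)).
    apply/has_iotaP; exists (cost s) => //.
    apply: (H s u 0) => //; last by rewrite addn0.
    by rewrite leq_add2l leq_mul2l sk orbT.
  elim: t w j => [|[[a b] w'] t IH] w j /=.
    by rewrite /cost big_nil addn0 => _ ->.
  move=> [Rab [x [y /= [wE w'E]]] dt] lt.
  rewrite /cost big_cons -/(cost _) /= addnA mulnDr => jk szw Sw.
  have ab := size_le_kappa Rab; rewrite /= in ab.
  have szw' : size w' + M * cost t <= size u + M * k.
    apply: leq_trans szw; rewrite addnA leq_add2r w'E wE !size_cat.
    by lia.
  have bnd (c : seq X) : size c <= size u + M * k -> word_code c < N.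
    by rewrite /N word_code_lt.
  have [xs ys] : size x <= size u + M * k /\ size y <= size u + M * k.
    by move: szw; rewrite wE !size_cat; lia.
  have [as_ bs] : size a <= size u + M * k /\ size b <= size u + M * k.
    by have : M * kappa (a, b) <= M * k; [rewrite leq_mul2l; lia | lia].
  apply: (IH w') => //.
  have /all_iotaP/(_ _ (bnd _ ys))/all_iotaP/(_ _ (bnd _ as_)) :=
    cl _ (bnd _ xs).
  move=> /all_iotaP/(_ _ (bnd _ bs))/all_iotaP/(_ j).
  rewrite !code_cat_word chiE kapE -wE -w'E Sw [_ < N]word_code_lt asboolT //=.
  rewrite andbT ltnS => H; apply: (implyP (H _)); first lia.
  lia.
Qed.

End Cost.

(** Non-emptiness matters: on the empty set [least] is 0 and the left side would hold for every
    [k]. *)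
Lemma least_leP (P : nat -> Prop) k :
  (exists i, P i) -> least P <= k <-> exists2 i, P i & i <= k.
Proof.
move=> exP; rewrite /least; case: pselect => [h|[]]; last first.
  by have [i Pi] := exP; exists i; apply/asboolP.
case: ex_minnP => m /asboolP Pm mmin.
split=> [mk|[i Pi]]; first by exists m.
by apply: leq_trans; apply: mmin; apply/asboolP.
Qed.

(** * The equivalence for an arbitrary computable cost *)

Section Equivalence.
Variables (X : finType) (R : set (seq X * seq X)).
Variable kappa : seq X * seq X -> nat.
Local Notation q := #|X|.

Definition min_cost u v :=
  least [set cost kappa s | s in derivation_from_to R u v]%classic.

Definition max_cost n1 n2 :=
  \max_(p : n1.-bseq X * n2.-bseq X | `[< relations R (val p.1, val p.2) >])
    min_cost (val p.1) (val p.2).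

Variables (M : nat) (kap : nat -> nat -> nat).
Hypothesis hsym : symmetric_rels R.
Hypothesis decR : decidable_words2 R.
Hypothesis kapP : computable2 kap.
Hypothesis kapE : forall u v, kap (word_code u) (word_code v) = kappa (u, v).
Hypothesis size_le_kappa : forall r, R r -> size r.1 + size r.2 <= M * kappa r.

Let chi m n : nat :=
  `[< [set (word_code p.1, word_code p.2) | p in R]%classic (m, n) >].

Let chiE u v : chi (word_code u) (word_code v) = `[< R (u, v) >].
Proof. by rewrite /chi decidable_words2_code. Qed.

Let test (u v : seq X) k := cost_le q M chi kap (word_code u) (word_code v) k.

Let testP u v k :
  test u v k <-> exists2 s, derivation_from_to R u v s & cost kappa s <= k.
Proof. exact: cost_leP. Qed.

Lemma min_cost_leP u v k :
  relations R (u, v) -> min_cost u v <= k <-> test u v k.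
Proof.
move=> /(relationsP hsym)[s ds]; rewrite /min_cost least_leP; last first.
  by exists (cost kappa s), s.
rewrite testP; split=> [[_ [t dt <-] tk]|[t dt tk]]; first by exists t.
by exists (cost kappa t) => //; exists t.
Qed.

Lemma max_cost_leP n1 n2 k :
  max_cost n1 n2 <= k <->
  forall u v, size u <= n1 -> size v <= n2 -> relations R (u, v) -> test u v k.
Proof.
split=> [/bigmax_leqP H u v un vn uv|H].
  by apply/min_cost_leP => //; apply: (H (Bseq un, Bseq vn)); apply/asboolP.
apply/bigmax_leqP => -[u v] /asboolP /= uv.
by apply/min_cost_leP => //; apply: H => //; apply: size_bseq.
Qed.

Lemma word_problem_computable : solvable_word_problem R -> computable2 max_cost.
Proof.
move=> wp; apply/computable2P.
pose rel m n : nat :=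
  `[< [set (word_code p.1, word_code p.2) | p in relations R]%classic (m, n) >].
have relE u v : rel (word_code u) (word_code v) = `[< relations R (u, v) >].
  by rewrite /rel decidable_words2_code.
(* Quantifying over codes below [geo q n] is quantifying over the words of length at most [n]. *)
pose bound n1 n2 k := all (fun a => all (fun b =>
  (0 < rel a b) ==> cost_le q M chi kap a b k) (iota 0 (geo q n2)))
  (iota 0 (geo q n1)).
have boundE n1 n2 k : bound n1 n2 k = (max_cost n1 n2 <= k).
  apply/idP/idP => [/all_iotaP H|/max_cost_leP H].
    apply/max_cost_leP => u v un vn uv.
    have := H (word_code u); rewrite word_code_lt => /(_ un)/all_iotaP.
    move=> /(_ (word_code v)); rewrite word_code_lt => /(_ vn)/implyP.
    by apply; rewrite relE asboolT.
  apply/all_iotaP => a /word_code_surj[u <- un].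
  apply/all_iotaP => b /word_code_surj[v <- vn].
  by rewrite relE lt0b; apply/implyP => /asboolP; apply: H.
(* Minimization looks for a zero, hence the negation; the search stops at [max_cost] itself. *)
apply: (@recursive_least _
  (fun k v => ~~ bound (thead v) (thead (behead_tuple v)) k)).
  rewrite /bound; recursivity.
  - by apply: (recursive_app2 wp); recursivity.
  - by apply: (recursive_cost_le _ _ decR kapP); recursivity.
move=> v; rewrite boundE leqnn; split=> // z zlt.
by rewrite boundE -ltnNge zlt.
Qed.

(** Related words are joined by a derivation of cost at most the bound at their lengths, and any
    derivation found shows that they are related. *)
Lemma bounded_word_problem :
  computably_bounded max_cost -> solvable_word_problem R.
Proof.
move=> [B BP leB]; apply/computable2P.
(* [a < geo q a] says that [a] is the code of a word, which fails for [a > 0]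
   when [X] is empty. *)
pose t a b := [&& a < geo q a, b < geo q b &
  cost_le q M chi kap a b (B (code_size q a) (code_size q b))].
apply: (@eq_recursive _ (fun v => t (thead v) (thead (behead_tuple v)))).
  move=> v; move: (thead v) (thead _) => a b; congr nat_of_bool.
  apply/idP/asboolP => [/and3P[]|[[u w] uw [<- <-]]].
    move=> /word_code_surj[u <- _] /word_code_surj[w <- _] /testP[s ds _].
    by exists (u, w) => //; apply/relationsP => //; exists s.
  rewrite /t !word_code_lt !leq_size_code !code_size_word /=.
  have /max_cost_leP := leB (size u) (size w); exact.
rewrite /t; recursivity.
apply: (recursive_cost_le _ _ decR kapP); recursivity.
by apply: (recursive_app2 BP); recursivity.
Qed.

Lemma word_problem_tfae :
  [<-> solvable_word_problem R; computable2 max_cost;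
       computably_bounded max_cost].
Proof.
tfae; [exact: word_problem_computable| |exact: bounded_word_problem].
by move=> c; exists max_cost.
Qed.

End Equivalence.

(** * Finite presentations and the two instances *)

Lemma finite_decidable_words2 (X : finType) (R : set (seq X * seq X)) :
  finite_set R -> decidable_words2 R.
Proof.
move=> /finite_seqP[s ->]; apply/computable2P.
apply: (@eq_recursive _ (fun v => has (fun p => (thead v == word_code p.1) &&
  (thead (behead_tuple v) == word_code p.2)) s)).
  move=> v; congr nat_of_bool; apply/hasP/asboolP.
    by move=> [p ps /andP[/eqP-> /eqP->]]; exists p.
  by move=> [p ps [<- <-]]; exists p; rewrite ?eqxx.
elim: s => [|p s IH] /=; first exact: (recursive_const _ 0).
have PP : recursive (fun v : 2.-tuple nat =>
    (thead v == word_code p.1) && (thead (behead_tuple v) == word_code p.2)).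
  apply: (@eq_recursive _ (fun v => (thead v <= word_code p.1) &&
      (word_code p.1 <= thead v) && ((thead (behead_tuple v) <= word_code p.2) &&
      (word_code p.2 <= thead (behead_tuple v))))).
    by move=> v; rewrite !eqn_leq.
  by recursivity.
(* The disjunction over the list is obtained by De Morgan from negation and conjunction. *)
apply: eq_recursive (recursive_neg
  (recursive_and (recursive_neg PP) (recursive_neg IH))).
by move=> v; rewrite -negb_or negbK.
Qed.

Lemma DL_max_cost (X : finType) (R : set (seq X * seq X)) :
  DL R = max_cost R (fun=> 1).
Proof.
apply/funext => n1; apply/funext => n2; apply: eq_bigr => p _.
congr least; apply/seteqP; split=> _ [s ds <-]; exists s => //;
  by rewrite /cost sum1_size.
Qed.

Theorem proposition5p11 (X : finType) (R : set (seq X * seq X))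
    (hsym : symmetric_rels R) :
  (decidable_words2 R ->
   [<-> solvable_word_problem R;
        computable2 (Omega R);
        computably_bounded (Omega R)])
  /\
  (finite_set R ->
   [<-> solvable_word_problem R;
        computable2 (DL R);
        computably_bounded (DL R)]).
Proof.
split=> [decR|finR].
  (* [Omega R] is convertible to [max_cost] for this cost, which is computed on codes through
     [code_size]. *)
  apply: (@word_problem_tfae X R (fun r => size r.1 + size r.2) 1
    (fun a b => code_size #|X| a + code_size #|X| b)) => //.
  - by apply/computable2P; recursivity.
  - by move=> u v; rewrite !code_size_word.
  - by move=> r _; rewrite mul1n.
have /finite_seqP[s sR] := finR.
rewrite DL_max_cost.
apply: (@word_problem_tfae X R (fun=> 1) (\max_(r <- s) (size r.1 + size r.2))
  (fun _ _ => 1)) => //.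
- exact: finite_decidable_words2.
- by apply/computable2P; apply: recursive_const.
- by move=> r; rewrite sR muln1 => /= rs; rewrite (big_rem r) //= leq_maxl.
Qed.
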